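(* The category $\mathbf{SPOL}_\bullet$ is isomorphic to the category $\mathbf{SIM}_\bullet$.
   Context: A p-site is a triple $\mathbf{a}=(I,A,(A_i)_{i\in I})$ with $I$ a finite set (the base), $A$ a set (the ground), and $A_i\subset A$ for each $i\in I$. Its effective ground is $A_\ast=\bigcup_{i\in I}A_i$ and its effective p-site is $\mathbf{a}_\ast=(I,A_\ast,(A_i)_{i\in I})$. For a function $\varphi:I\to J$, $\hat\varphi:\mathcal{P}(I)\to\mathcal{P}(J)$ is $\hat\varphi(s)=\{\varphi(i):i\in s\}$. Given p-sites $\mathbf{a}=(I,A,(A_i))$ and $\mathbf{b}=(J,B,(B_j))$, an S-map $\mathbf{a}\to\mathbf{b}$ is a pair $(\varphi,f)$ of functions $\varphi:I\to J$, $f:A\to B$ with $\bigcup_{i\in\varphi^{-1}(j)}A_i\subset f^{-1}(B_j)$ for all $j\in J$. When $I=J$, an SG-map $\mathbf{a}\to\mathbf{b}$ is a function $f:A\to B$ with $f(A_i)\subset B_i$ for all $i\in I$. Let $\mathbf{spol}_{\bullet/s}(\mathbf{a},\mathbf{b})$ be the set of functions $\varphi:I\to J$ for which there exists $f_\ast:A_\ast\to B_\ast$ such that $(\varphi,f_\ast)$ is an S-map $\mathbf{a}_\ast\to\mathbf{b}_\ast$. Write $\mathbf{a}\sim_S\mathbf{a}'$ if $\mathbf{a}$ and $\mathbf{a}'$ have the same base and there exist an SG-map $\mathbf{a}_\ast\to\mathbf{a}'_\ast$ and an SG-map $\mathbf{a}'_\ast\to\mathbf{a}_\ast$. This is an equivalence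 relation on p-sites, and $\mathbf{spol}_{\bullet/s}(\mathbf{a},\mathbf{b})=\mathbf{spol}_{\bullet/s}(\mathbf{a}',\mathbf{b}')$ whenever $\mathbf{a}\sim_S\mathbf{a}'$ and $\mathbf{b}\sim_S\mathbf{b}'$. Category $\mathbf{SPOL}_\bullet$: objects are the $\sim_S$-equivalence classes $\dot{\mathbf{a}}$ of p-sites; morphisms are $\mathbf{SPOL}_\bullet(\dot{\mathbf{a}},\dot{\mathbf{b}})=\mathbf{spol}_{\bullet/s}(\mathbf{a},\mathbf{b})$, with composition of functions and identity $id_I$. Category $\mathbf{SIM}_\bullet$: objects are pairs $(I,\mathcal{E})$ with $I$ a finite set and $\mathcal{E}$ an $I$-simplicial complex, i.e. a set of nonempty subsets of $I$ closed under taking nonempty subsets (not every singleton need be in $\mathcal{E}$, and $\mathcal{E}$ may be empty); a morphism $(I,\mathcal{E})\to(J,\mathcal{F})$ is a function $\varphi:I\to J$ with $\hat\varphi(s)\in\mathcal{F}$ for all $s\in\mathcal{E}$; composition is composition of functions. *)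

(* Defs.v *)
From HB Require Import structures.
From mathcomp Require Import all_boot.
From mathcomp Require Import boolp classical_sets.

Set Implicit Arguments.
Unset Strict Implicit.
Unset Printing Implicit Defensive.

Local Open Scope classical_set_scope.

Record category := Category {
  Obj :> Type;
  Hom : Obj -> Obj -> Type;
  idc : forall x, Hom x x;
  compc : forall x y z, Hom y z -> Hom x y -> Hom x z;
  compcA : forall x y z t (h : Hom z t) (g : Hom y z) (f : Hom x y),
    compc h (compc g f) = compc (compc h g) f;
  comp1c : forall x y (f : Hom x y), compc (idc y) f = f;
  compc1 : forall x y (f : Hom x y), compc f (idc x) = f }.

Record functor (C D : category) := Functor {
  fobj :> C -> D;
  fhom : forall x y : C, Hom x y -> Hom (fobj x) (fobj y);
  fhom1 : forall x : C, fhom (idc x) = idc (fobj x);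
  fhomM : forall (x y z : C) (g : Hom y z) (f : Hom x y),
    fhom (compc g f) = compc (fhom g) (fhom f) }.

Definition functor_id (C : category) : functor C C :=
  @Functor C C id (fun _ _ f => f) (fun=> erefl) (fun _ _ _ _ _ => erefl).

Lemma fcomp1 (C D E : category) (G : functor D E) (F : functor C D) (x : C) :
  fhom G (fhom F (idc x)) = idc (G (F x)).
Proof. by rewrite !fhom1. Qed.

Lemma fcompM (C D E : category) (G : functor D E) (F : functor C D)
    (x y z : C) (g : Hom y z) (f : Hom x y) :
  fhom G (fhom F (compc g f)) =
  compc (fhom G (fhom F g)) (fhom G (fhom F f)).
Proof. by rewrite !fhomM. Qed.

Definition functor_comp (C D E : category)
    (G : functor D E) (F : functor C D) : functor C E :=
  @Functor C E (fun x => G (F x)) (fun _ _ f => fhom G (fhom F f))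
    (fcomp1 G F) (fcompM G F).

Definition isomorphic_categories (C D : category) : Prop :=
  exists (F : functor C D) (G : functor D C),
    functor_comp G F = functor_id C /\ functor_comp F G = functor_id D.

(* p-sites with base I: sharing a base is sharing the index I. *)
Record psite (I : finType) := PSite {
  ground : Type;
  part : I -> set ground }.

Arguments part {I} p i.

Definition eground (I : finType) (a : psite I) : set (ground a) :=
  \bigcup_i part a i.

Arguments eground {I} a.

Definition epsite (I : finType) (a : psite I) : psite I :=
  @PSite I (set_type (eground a)) (fun i => val @^-1` part a i).

Definition is_Smap (I J : finType) (a : psite I) (b : psite J)
    (phi : I -> J) (f : ground a -> ground b) : Prop :=
  forall j : J,
    \bigcup_(i in phi @^-1` [set j]) part a i `<=` f @^-1` part b j.

Definition is_SGmap (I : finType) (a b : psite I)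
    (f : ground a -> ground b) : Prop :=
  forall i : I, f @` part a i `<=` part b i.

Definition spol (I J : finType) (a : psite I) (b : psite J) : set (I -> J) :=
  [set phi | exists f : ground (epsite a) -> ground (epsite b),
     is_Smap phi f].

Arguments spol {I J} a b.

Definition simS (I : finType) (a a' : psite I) : Prop :=
  (exists f : ground (epsite a) -> ground (epsite a'), is_SGmap f) /\
  (exists g : ground (epsite a') -> ground (epsite a), is_SGmap g).

Lemma simS_refl (I : finType) (a : psite I) : simS a a.
Proof. by split; exists id => i _ [x ax <-]. Qed.

Lemma simS_sym (I : finType) (a b : psite I) : simS a b -> simS b a.
Proof. by case. Qed.

Lemma SGmap_comp (I : finType) (a b c : psite I)
    (f : ground a -> ground b) (g : ground b -> ground c) :
  is_SGmap f -> is_SGmap g -> is_SGmap (g \o f).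
Proof.
by move=> Hf Hg i _ [x ax <-]; apply: Hg; exists (f x) => //; apply: Hf; exists x.
Qed.

Lemma simS_trans (I : finType) (a b c : psite I) :
  simS a b -> simS b c -> simS a c.
Proof.
move=> [[f Hf] [f' Hf']] [[g Hg] [g' Hg']]; split.
  by exists (g \o f); apply: SGmap_comp.
by exists (f' \o g'); apply: SGmap_comp.
Qed.

Lemma spol_id (I : finType) (a b : psite I) : simS a b -> spol a b id.
Proof. by move=> [[f Hf] _]; exists f => j x [i /= -> ax]; apply: Hf; exists x. Qed.

Lemma spol_comp (I J K : finType) (a : psite I) (b : psite J) (c : psite K)
    (psi : J -> K) (phi : I -> J) :
  spol b c psi -> spol a b phi -> spol a c (psi \o phi).
Proof.
move=> [g Hg] [f Hf]; exists (g \o f) => _ x [i /= <- ax].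
by apply: Hg; exists (phi i) => //; apply: Hf; exists i.
Qed.

Lemma spol_simS (I J : finType) (a a' : psite I) (b b' : psite J) :
  simS a a' -> simS b b' -> spol a b = spol a' b'.
Proof.
suff H (c c' : psite I) (d d' : psite J) :
    simS c c' -> simS d d' -> spol c d `<=` spol c' d'.
  by move=> aa' bb'; apply/seteqP; split; apply: H => //; apply: simS_sym.
move=> /simS_sym/spol_id cc' /spol_id dd' phi Hphi.
exact: (spol_comp dd' (spol_comp Hphi cc')).
Qed.

(* Classes of p-sites are plain predicates: "set" is not universe polymorphic
   and already occurs in psite, so "set (psite I)" is inconsistent. *)
Definition simS_class (I : finType) (a : psite I) : psite I -> Prop := simS a.


Record spol_obj := SpolObj {
  spol_base : finType;
  spol_class : psite spol_base -> Prop;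
  spol_classP : exists a, spol_class = simS_class a }.

Arguments spol_class s : clear implicits.

Definition class_of (I : finType) (a : psite I) : spol_obj :=
  @SpolObj I (simS_class a) (ex_intro _ a erefl).

(* By spol_hom_setE below, this is spol a b for any representatives a, b. *)
Definition spol_hom_set (x y : spol_obj) : set (spol_base x -> spol_base y) :=
  [set phi | exists a b,
     [/\ spol_class x a, spol_class y b & spol a b phi]].

Arguments spol_hom_set x y : clear implicits.

Lemma spol_hom_setE (I J : finType) (a : psite I) (b : psite J) :
  spol_hom_set (class_of a) (class_of b) = spol a b.
Proof.
apply/seteqP; split=> phi /=.
  by move=> [a' [b' [/= aa' bb' H]]]; rewrite (spol_simS aa' bb').
by move=> H; exists a, b; split=> //; apply: simS_refl.
Qed.

Definition spol_hom (x y : spol_obj) : Type :=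
  {phi : spol_base x -> spol_base y | spol_hom_set x y phi}.

Lemma spol_hom_set_id (x : spol_obj) :
  spol_hom_set x x id.
Proof.
case: x => I X [a EX]; exists a, a.
by rewrite /= EX; split; [exact: simS_refl..|apply: spol_id; exact: simS_refl].
Qed.

Lemma spol_hom_set_comp (x y z : spol_obj)
    (g : spol_base y -> spol_base z) (f : spol_base x -> spol_base y) :
  spol_hom_set y z g -> spol_hom_set x y f -> spol_hom_set x z (g \o f).
Proof.
move=> [b [c [yb zc Hg]]] [a [b' [xa yb' Hf]]]; exists a, c; split=> //.
apply: spol_comp Hg _; suff bb' : simS b' b.
  by rewrite -(spol_simS (simS_refl a) bb').
have [b0 EY] := spol_classP y.
rewrite EY in yb yb'.
exact: simS_trans (simS_sym yb') yb.
Qed.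

Definition spol_idc (x : spol_obj) : spol_hom x x :=
  exist _ id (spol_hom_set_id x).

Definition spol_compc (x y z : spol_obj)
    (g : spol_hom y z) (f : spol_hom x y) : spol_hom x z :=
  exist _ (sval g \o sval f) (spol_hom_set_comp (svalP g) (svalP f)).

Lemma spol_compA (x y z t : spol_obj)
    (h : spol_hom z t) (g : spol_hom y z) (f : spol_hom x y) :
  spol_compc h (spol_compc g f) = spol_compc (spol_compc h g) f.
Proof. exact: eq_exist. Qed.

Lemma spol_comp1 (x y : spol_obj) (f : spol_hom x y) :
  spol_compc (spol_idc y) f = f.
Proof. by case: f => f Hf; apply: eq_exist. Qed.

Lemma spol_compc1 (x y : spol_obj) (f : spol_hom x y) :
  spol_compc f (spol_idc x) = f.
Proof. by case: f => f Hf; apply: eq_exist. Qed.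

Definition SPOL : category :=
  Category spol_compA spol_comp1 spol_compc1.

(* Singletons need not be faces: the vertex set may be smaller than I. *)
Record simplicial_complex (I : finType) := SimplicialComplex {
  faces :> {set {set I}};
  faces_neq0 : forall s, s \in faces -> s != finset.set0;
  faces_sub : forall s t : {set I},
    s \in faces -> t != finset.set0 -> t \subset s -> t \in faces }.

Record sim_obj := SimObj {
  sim_base : finType;
  sim_complex : simplicial_complex sim_base }.

Definition is_simplicial (I J : finType)
    (E : simplicial_complex I) (F : simplicial_complex J) (phi : I -> J) : Prop :=
  forall s : {set I}, s \in faces E -> (phi @: s)%SET \in faces F.

Definition sim_hom (x y : sim_obj) : Type :=
  {phi : sim_base x -> sim_base y |
    is_simplicial (sim_complex x) (sim_complex y) phi}.

Lemma is_simplicial_id (I : finType) (E : simplicial_complex I) :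
  is_simplicial E E id.
Proof. by move=> s Es; rewrite imset_id. Qed.

Lemma is_simplicial_comp (I J K : finType) (E : simplicial_complex I)
    (F : simplicial_complex J) (H : simplicial_complex K)
    (psi : J -> K) (phi : I -> J) :
  is_simplicial F H psi -> is_simplicial E F phi ->
  is_simplicial E H (psi \o phi).
Proof. by move=> Hpsi Hphi s Es; rewrite imset_comp; apply: Hpsi; apply: Hphi. Qed.

Definition sim_idc (x : sim_obj) : sim_hom x x :=
  exist _ id (@is_simplicial_id _ (sim_complex x)).

Definition sim_compc (x y z : sim_obj)
    (g : sim_hom y z) (f : sim_hom x y) : sim_hom x z :=
  exist _ (sval g \o sval f) (is_simplicial_comp (svalP g) (svalP f)).

Lemma sim_compA (x y z t : sim_obj)
    (h : sim_hom z t) (g : sim_hom y z) (f : sim_hom x y) :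
  sim_compc h (sim_compc g f) = sim_compc (sim_compc h g) f.
Proof. exact: eq_exist. Qed.

Lemma sim_comp1 (x y : sim_obj) (f : sim_hom x y) :
  sim_compc (sim_idc y) f = f.
Proof. by case: f => f Hf; apply: eq_exist. Qed.

Lemma sim_compc1 (x y : sim_obj) (f : sim_hom x y) :
  sim_compc f (sim_idc x) = f.
Proof. by case: f => f Hf; apply: eq_exist. Qed.

Definition SIM : category :=
  Category sim_compA sim_comp1 sim_compc1.

(* Main.v *)
(* The isomorphism sends a p-site to its nerve, the complex of nonempty s <= I
   for which the A_i, i in s, share a point.  A function phi is in spol a b iff
   it is simplicial between the nerves: a point x of the effective ground may be
   sent to any common point of the B_j, j in phi(s), where s is the face of all
   i with x in A_i.  In particular, a and a' are equivalent iff their nerves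
   agree.  Conversely a complex E is the nerve of the p-site with ground the
   subsets of I, A_i being the set of faces containing i. *)
From Stdlib Require Import JMeq.
From mathcomp Require Import all_boot.
From mathcomp Require Import boolp classical_sets.
Require Import Defs.

Set Implicit Arguments.
Unset Strict Implicit.
Unset Printing Implicit Defensive.

Local Open Scope classical_set_scope.

(** The two images of [f] lie in Hom-types that agree only once the object maps are identified,
    hence [JMeq]. The functor laws are propositions, so they are proof-irrelevant. *)
Lemma functor_ext (C D : category) (F G : functor C D) :
  (forall x, F x = G x) ->
  (forall (x y : C) (f : Hom x y), JMeq (fhom F f) (fhom G f)) -> F = G.
Proof.
case: F G => [Fo Fh F1 FM] [Go Gh G1 GM] /= eo.
have {}eo : Fo = Go by apply: funext.
case: Go / eo Gh G1 GM => Gh G1 GM eh.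
have {}eh : Fh = Gh.
  apply: functional_extensionality_dep => x.
  apply: functional_extensionality_dep => y.
  by apply: functional_extensionality_dep => f; apply: JMeq_eq.
case: Gh / eh G1 GM => G1 GM.
by rewrite (Prop_irrelevance F1 G1) (Prop_irrelevance FM GM).
Qed.

Lemma simplicial_complex_inj (I : finType) : injective (@faces I).
Proof.
move=> [E E0 Es] [F F0 Fs] /= eEF; case: F / eEF F0 Fs => F0 Fs.
by rewrite (Prop_irrelevance E0 F0) (Prop_irrelevance Es Fs).
Qed.

Section Nerve.
Variables (I : finType) (a : psite I).

Definition nerve_faces : {set {set I}} :=
  [set s : {set I} | (s != finset.set0) &&
     `[< exists x, forall i, i \in s -> part a i x >]]%SET.

Lemma nerve_facesP (s : {set I}) :
  reflect (s != finset.set0 /\ exists x, forall i, i \in s -> part a i x)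
          (s \in nerve_faces).
Proof.
by rewrite inE; apply: (iffP andP) => -[s0 /asboolP sx]; split=> //; apply/asboolP.
Qed.

Lemma nerve_faces_neq0 s : s \in nerve_faces -> s != finset.set0.
Proof. by case/nerve_facesP. Qed.

Lemma nerve_faces_sub (s t : {set I}) :
  s \in nerve_faces -> t != finset.set0 -> t \subset s -> t \in nerve_faces.
Proof.
case/nerve_facesP => _ [x sx] t0 /fintype.subsetP ts; apply/nerve_facesP; split=> //.
by exists x => i /ts /sx.
Qed.

Definition nerve : simplicial_complex I :=
  SimplicialComplex nerve_faces_neq0 nerve_faces_sub.

End Nerve.

Lemma spol_simplicial (I J : finType) (a : psite I) (b : psite J)
    (phi : I -> J) : spol a b phi <-> is_simplicial (nerve a) (nerve b) phi.
Proof.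
split=> [[f Hf] s /nerve_facesP [s0 [x sx]]|H].
  have [i si] := set0Pn _ s0.
  (* Since [s] is nonempty, its common point lies in the effective ground, where [f] is defined. *)
  have xa : x \in eground a by rewrite inE; exists i => //; exact: sx.
  apply/nerve_facesP; split; first by apply/set0Pn; exists (phi i); exact: imset_f.
  exists (val (f (SigSub xa))) => _ /imsetP [k sk ->].
  by apply: (Hf (phi k)); exists k => //; exact: sx.
suff /choice [f Hf] : forall x : ground (epsite a), exists y : ground (epsite b),
    forall i, part a i (val x) -> part b (phi i) (val y).
  by exists f => _ x [i <- ax]; exact: Hf.
case=> x /= xa; have /set_mem [i _ xi] := xa.
(* This is the largest face witnessed by [x]; one common point for its image serves every [part a k]
   containing [x] at once. *)
pose s := [set k | `[< part a k x >]]%SET.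
have si : i \in s by rewrite inE; apply/asboolP.
have /H /nerve_facesP [_ [y sy]] : s \in faces (nerve a).
  apply/nerve_facesP; split; first by apply/set0Pn; exists i.
  by exists x => k; rewrite inE => /asboolP.
have yb : y \in eground b.
  by rewrite inE; exists (phi i) => //; apply: sy; exact: imset_f.
exists (SigSub yb) => k xk; apply: sy; apply: imset_f.
by rewrite inE; apply/asboolP.
Qed.

Lemma spol_id_SGmap (I : finType) (a b : psite I) : spol a b id ->
  exists f : ground (epsite a) -> ground (epsite b), is_SGmap f.
Proof. by case=> f Hf; exists f => i _ [x ax <-]; apply: Hf; exists i. Qed.

(** Equivalence means that [id] lies in [spol] in both directions, and [id] is simplicial exactly
    when one complex is included in the other. *)
Lemma simS_nerve (I : finType) (a b : psite I) :
  simS a b <-> nerve a = nerve b.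
Proof.
split=> [ab|eab].
  have /spol_simplicial sab := spol_id ab.
  have /spol_simplicial sba := spol_id (simS_sym ab).
  apply: simplicial_complex_inj; apply/setP => s.
  by apply/idP/idP => [/sab|/sba]; rewrite imset_id.
by split; apply/spol_id_SGmap/spol_simplicial; rewrite eab; apply: is_simplicial_id.
Qed.

Lemma simS_classE (I : finType) (a b : psite I) :
  simS a b -> simS_class a = simS_class b.
Proof.
move=> ab; apply: funext => c; apply: propext.
by split; apply: simS_trans => //; apply: simS_sym.
Qed.

(** Subsets that are not faces lie in no part, so the effective ground consists of the faces
    alone. *)
Definition face_psite (I : finType) (E : simplicial_complex I) : psite I :=
  @PSite I {set I} (fun i s => s \in faces E /\ i \in s).

(** A face is itself a common point of the parts indexed by its elements. Conversely, a common point
    for a nonempty [s] is a face containing [s], and faces are closed under nonempty subsets. *)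
Lemma nerve_face_psite (I : finType) (E : simplicial_complex I) :
  nerve (face_psite E) = E.
Proof.
apply: simplicial_complex_inj; apply/setP => s.
apply/nerve_facesP/idP => [[s0 [t st]]|Es]; last first.
  by split; [exact: faces_neq0 Es | exists s].
have [i /st [Et _]] := set0Pn _ s0.
by apply: faces_sub Et s0 _; apply/fintype.subsetP => k /st [].
Qed.

Lemma spol_repr_subproof (x : spol_obj) :
  {a : psite (spol_base x) | spol_class x = simS_class a}.
Proof. exact: cid (spol_classP x). Qed.

Definition spol_repr (x : spol_obj) : psite (spol_base x) :=
  sval (spol_repr_subproof x).

Lemma spol_reprE (x : spol_obj) : spol_class x = simS_class (spol_repr x).
Proof. exact: svalP (spol_repr_subproof x). Qed.

(** The chosen representative is equivalent to [a], so the choice does not affect the nerve. *)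
Lemma nerve_spol_repr_class_of (I : finType) (a : psite I) :
  nerve (spol_repr (class_of a)) = nerve a.
Proof.
apply/simS_nerve; apply: simS_sym.
have := simS_refl (spol_repr (class_of a)).
by rewrite -/(simS_class _ _) -spol_reprE.
Qed.

Lemma spol_hom_set_simplicial (x y : spol_obj)
    (phi : spol_base x -> spol_base y) : spol_hom_set x y phi <->
  is_simplicial (nerve (spol_repr x)) (nerve (spol_repr y)) phi.
Proof.
rewrite -spol_simplicial; split=> [[a [b []]]|H].
  by rewrite !spol_reprE => xa yb; rewrite (spol_simS xa yb).
by exists (spol_repr x), (spol_repr y); rewrite !spol_reprE; split=> //;
  exact: simS_refl.
Qed.

Lemma spol_hom_set_class_of (x y : sim_obj)
    (phi : sim_base x -> sim_base y) :
  is_simplicial (sim_complex x) (sim_complex y) phi ->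
  spol_hom_set (class_of (face_psite (sim_complex x)))
               (class_of (face_psite (sim_complex y))) phi.
Proof. by rewrite spol_hom_setE spol_simplicial !nerve_face_psite. Qed.

(** Morphisms keep their underlying function; only the proof attached to it changes. *)
Definition nerve_functor : functor SPOL SIM.
Proof.
unshelve refine (@Functor SPOL SIM (fun x => SimObj (nerve (spol_repr x)))
  (fun x y f => exist _ (sval f) _) _ _).
- by apply/spol_hom_set_simplicial; exact: svalP.
- by move=> x; exact: eq_exist.
- by move=> x y z g f; exact: eq_exist.
Defined.

Definition face_functor : functor SIM SPOL.
Proof.
unshelve refine (@Functor SIM SPOL
  (fun x => class_of (face_psite (sim_complex x)))
  (fun x y f => exist _ (sval f) _) _ _).
- by apply: spol_hom_set_class_of; exact: svalP.
- by move=> x; exact: eq_exist.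
- by move=> x y z g f; exact: eq_exist.
Defined.

Lemma SpolObj_eq (I : finType) (X Y : psite I -> Prop) HX HY :
  X = Y -> @SpolObj I X HX = @SpolObj I Y HY.
Proof. by move=> eXY; case: Y / eXY HY => HY; rewrite (Prop_irrelevance HX HY). Qed.

(** Both sides share the bases [I] and [J], so substituting the classes makes the Hom-types coincide
    and leaves only the functions to compare. *)
Lemma spol_hom_JMeq (I J : finType) (X X' : psite I -> Prop)
    (Y Y' : psite J -> Prop) HX HX' HY HY'
    (f : spol_hom (@SpolObj I X HX) (@SpolObj J Y HY))
    (g : spol_hom (@SpolObj I X' HX') (@SpolObj J Y' HY')) :
  X = X' -> Y = Y' -> sval f = sval g -> JMeq f g.
Proof.
move=> eX eY; case: X' / eX HX' g => HX'; case: Y' / eY HY' => HY'.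
rewrite (Prop_irrelevance HX' HX) (Prop_irrelevance HY' HY).
by case: f => f Hf [g Hg] /= efg; rewrite (eq_exist _ _ efg).
Qed.

Lemma sim_hom_JMeq (I J : finType) (E E' : simplicial_complex I)
    (F F' : simplicial_complex J)
    (f : sim_hom (SimObj E) (SimObj F)) (g : sim_hom (SimObj E') (SimObj F')) :
  E = E' -> F = F' -> sval f = sval g -> JMeq f g.
Proof.
move=> eE eF; case: E' / eE g; case: F' / eF.
by case: f => f Hf [g Hg] /= efg; rewrite (eq_exist _ _ efg).
Qed.

Lemma face_nerve_class (x : spol_obj) :
  simS_class (face_psite (nerve (spol_repr x))) = spol_class x.
Proof.
by rewrite spol_reprE; apply/simS_classE/simS_nerve; exact: nerve_face_psite.
Qed.

Lemma nerve_face_complex (I : finType) (E : simplicial_complex I) :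
  nerve (spol_repr (class_of (face_psite E))) = E.
Proof. by rewrite nerve_spol_repr_class_of nerve_face_psite. Qed.

Theorem theorem5p2p9 : isomorphic_categories SPOL SIM.
Proof.
exists nerve_functor, face_functor; split; apply: functor_ext => /=.
(* The round trip leaves the base unchanged, so only the classes need comparing. *)
- by move=> x; have := face_nerve_class x; case: x => I X HX; exact: SpolObj_eq.
- move=> x y f; have := face_nerve_class x; have := face_nerve_class y.
  case: x y f => [I X HX] [J Y HY] f eY eX.
  exact: spol_hom_JMeq eX eY _.
- by case=> I E; rewrite nerve_face_complex.
- case=> [I E] [J F] f.
  by apply: sim_hom_JMeq; [exact: nerve_face_complex.. |].
Qed.
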